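(* Let $\tilde g:{S_k}^n\to\mathbb{R}$ be a Potts $k$-submodular function with associated posets $\Sigma_1,\dots,\Sigma_k$ and poset with inconsistent pairs (PIP) $P=\bigcup_{\alpha=1}^k\Sigma_\alpha\times\{\alpha\}$, all defined as in the context. For distinct $\alpha,\beta\in\{1,\dots,k\}$ let $\Sigma_{\alpha,\beta}=\Sigma_\alpha\cap\Sigma_\beta$, regarded as a subposet of $\Sigma_\alpha$, and let $\Sigma_{\alpha,0}=\Sigma_\alpha\setminus\bigcup_{\beta\ne\alpha}\Sigma_{\alpha,\beta}$. Let $R=\bigcup_{1\le\alpha<\beta\le k}\Sigma_{\alpha,\beta}$ be the poset whose order on each $\Sigma_{\alpha,\beta}$ ($\alpha<\beta$) is that of $\Sigma_{\alpha,\beta}$, with no relation between $\Sigma_{\alpha,\beta}$ and $\Sigma_{\alpha',\beta'}$ for $(\alpha,\beta)\ne(\alpha',\beta')$. For an ideal $J$ of $R$ let $$\overline J=\Bigl(\bigcup_{1\le\alpha\le k}\Sigma_{\alpha,0}\times\{\alpha\}\Bigr)\cup\Bigl(\bigcup_{1\le\alpha<\beta\le k}\bigl((J\cap\Sigma_{\alpha,\beta})\times\{\alpha\}\bigr)\cup\bigl((\Sigma_{\beta,\alpha}\setminus J)\times\{\beta\}\bigr)\Bigr).$$ Then the map $J\mapsto\overline J$ is a bijection from the ideal family of $R$ to the family $\mathcal{C}_{\max}(P)$ of maximal consistent ideals of $P$.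
   Context: $k$-submodularity. $S_k=\{0,\dots,k\}$ with $a\preceq b$ iff $a\in\{0,b\}$, and ${S_k}^n$ has the componentwise order. $x\sqcap y$, $x\sqcup y$ are componentwise $\min$, $\max$ with respect to $\preceq$ when $x_i,y_i$ are comparable, and $0$ otherwise. A function $f$ is $k$-submodular if $f(x)+f(y)\ge f(x\sqcap y)+f(x\sqcup y)$ for all $x,y$. Potts $k$-submodular function. $(V,E)$ is a connected undirected graph, $V=\{1,\dots,n\}$, with positive edge weights $\lambda_{i,j}$, and $\tilde g(x)=\sum_i\tilde g_i(x_i)+\sum_{\{i,j\}\in E}\lambda_{i,j}d(x_i,x_j)$, where each $\tilde g_i:S_k\to\mathbb{R}$ is any $k$-submodular function and $d(a,b)=1$ if $0\ne a\ne b\ne0$, $0$ if $a=b$, $1/2$ otherwise. Network $N$ (undirected). For each $i$ choose a minimizer $\gamma_i\in S_k$ of $\tilde g_i$, and put $\mu_i=2(\tilde g_i(0)-\tilde g_i(\gamma_i))\ge0$ and $\sigma_{i,\alpha}=\tilde g_i(\alpha)-2\tilde g_i(0)+\tilde g_i(\gamma_i)$ for $\alpha\in\{1,\dots,k\}$. Start from $(V,E)$ with capacities $c(\{i,j\})=\lambda_{i,j}$. Add new vertices $s_1,\dots,s_k$ (terminals). For each $i$ with $\mu_i>0$ (then $\gamma_i\ne0$), add an edge $\{i,s_{\gamma_i}\}$ of capacity $\mu_i$. For each $i$ and $\alpha\in\{1,\dots,k\}$ with $\sigma_{i,\alpha}>0$, add a new vertex $i^\alpha$ (the $\alpha$-fringe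 of $i$) and an edge $\{i,i^\alpha\}$ of capacity $2\sigma_{i,\alpha}$. Posets $\Sigma_\alpha$. $\overrightarrow N$ is obtained from $N$ by replacing each edge $\{u,v\}$ by directed edges $(u,v)$, $(v,u)$, each of capacity $c(\{u,v\})$. For each $\alpha$, take the network obtained from $\overrightarrow N$ by removing all $\beta$-fringes with $\beta\ne\alpha$ and contracting all terminals $s_\beta$ ($\beta\ne\alpha$) and all $\alpha$-fringes into a single terminal $s'$; $G_\alpha$ is the residual graph of a maximum $(s_\alpha,s')$-flow $\phi$ in it (edges: directed edges $a$ with $\phi(a)<c(a)$, and reverses of edges with $\phi(a)>0$). $\Sigma_\alpha$ is the set of strongly connected components of $G_\alpha$ that are neither reachable from $s_\alpha$ nor reachable to $s'$, with $X\le_\alpha Y$ iff $X$ is reachable from $Y$ in $G_\alpha$. Elements of $\Sigma_\alpha$ are subsets of $V$. The PIP $P$. On $P=\bigcup_\alpha\Sigma_\alpha\times\{\alpha\}$: $(X,\alpha)\le(Y,\beta)$ iff $\alpha=\beta$ and $X\le_\alpha Y$; the minimally inconsistent pairs are $\{(X,\alpha),(X,\beta)\}$ with $\alpha\ne\beta$ and $X\in\Sigma_\alpha\cap\Sigma_\beta$. An ideal is a down-closed subset (possibly empty); an ideal of $P$ is consistent if it contains no minimally inconsistent pair. Maximality is with respect to inclusion.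
   Formalization: Added assumption: there are no three distinct labels a, b, c with g̃_i(a)=g̃_i(b)=g̃_i(c)=g̃_i(0) for every i; otherwise V lies in Σ_a, Σ_b and Σ_c and the map is not a bijection (e.g. k=3, n=1, g̃_1=0: R has 2 ideals, but P has 3 maximal consistent ideals). *)

(* Defs.v *)
From HB Require Import structures.
From mathcomp Require Import all_boot all_order all_algebra.
From mathcomp Require Import reals.
Set Implicit Arguments.
Unset Strict Implicit.
Unset Printing Implicit Defensive.
Import Order.TTheory GRing.Theory Num.Theory.
Local Open Scope ring_scope.

(* [S_k] is [option 'I_k]: [None] is the element 0, and [Some a], for
   [a : 'I_k], is the nonzero label a + 1. *)
Notation Sk k := (option 'I_k).

Section KSubmodular.
Variable k : nat.

Definition sk_le (a b : Sk k) : bool := (a == None) || (a == b).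

Definition sk_meet (a b : Sk k) : Sk k :=
  if sk_le a b then a else if sk_le b a then b else None.

Definition sk_join (a b : Sk k) : Sk k :=
  if sk_le a b then b else if sk_le b a then a else None.

Definition ksubmodular (R : realType) (n : nat)
    (f : {ffun 'I_n -> Sk k} -> R) : Prop :=
  forall x y : {ffun 'I_n -> Sk k},
    f [ffun i => sk_meet (x i) (y i)] + f [ffun i => sk_join (x i) (y i)]
      <= f x + f y.

(* A function on [S_k] is a function on [S_k ^ 1]. *)
Definition ksubmodular1 (R : realType) (h : Sk k -> R) : Prop :=
  ksubmodular (fun x : {ffun 'I_1 -> Sk k} => h (x ord0)).

Definition potts_dist (R : realType) (a b : Sk k) : R :=
  if [&& a != None, b != None & a != b] then 1
  else if a == b then 0 else 2^-1.

(* The sum over unordered edges {i, j} runs over the pairs with i < j. *)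
Record is_potts (R : realType) (n : nat) (e : rel 'I_n)
    (lam : 'I_n -> 'I_n -> R) (gi : 'I_n -> Sk k -> R)
    (g : {ffun 'I_n -> Sk k} -> R) : Prop := IsPotts {
  potts_edge_sym : symmetric e;
  potts_edge_irr : irreflexive e;
  potts_connected : forall i j, connect e i j;
  potts_lam_sym : forall i j, e i j -> lam i j = lam j i;
  potts_lam_pos : forall i j, e i j -> 0 < lam i j;
  potts_unary : forall i, ksubmodular1 (gi i);
  potts_eq : forall x, g x = \sum_(i < n) gi i (x i)
    + \sum_(i < n) \sum_(j < n | (i < j)%N && e i j)
        lam i j * potts_dist R (x i) (x j) }.

End KSubmodular.

Section MaxFlow.
(* Directed multigraph on [W]: arcs [a \in A], from [src a] to [tgt a], of
   capacity [c a]. *)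
Variables (R : realType) (Arc W : finType) (A : {set Arc}).
Variables (src tgt : Arc -> W) (c : Arc -> R) (s t : W).

Definition is_flow (phi : Arc -> R) : Prop :=
  (forall a, a \in A -> 0 <= phi a <= c a) /\
  (forall x, x != s -> x != t ->
     \sum_(a in A | tgt a == x) phi a = \sum_(a in A | src a == x) phi a).

Definition flow_value (phi : Arc -> R) : R :=
  \sum_(a in A | src a == s) phi a - \sum_(a in A | tgt a == s) phi a.

Definition is_max_flow (phi : Arc -> R) : Prop :=
  is_flow phi /\ forall psi, is_flow psi -> flow_value psi <= flow_value phi.

Definition residual (phi : Arc -> R) : rel W := fun x y =>
  [exists a in A, [&& src a == x, tgt a == y & phi a < c a]
               || [&& src a == y, tgt a == x & 0 < phi a]].

End MaxFlow.

Definition sccs (W : finType) (r : rel W) : {set {set W}} :=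
  equivalence_partition (fun x y => connect r x y && connect r y x) [set: W].

Section Network.
Variables (R : realType) (k n : nat) (e : rel 'I_n).
Variables (lam : 'I_n -> 'I_n -> R) (gi : 'I_n -> Sk k -> R).
Variable gam : 'I_n -> Sk k.

Definition mu (i : 'I_n) : R := 2 * (gi i None - gi i (gam i)).

Definition sigma (i : 'I_n) (a : 'I_k) : R :=
  gi i (Some a) - 2 * gi i None + gi i (gam i).

(* [inl (inl i)] is the vertex i, [inl (inr a)] the terminal s_a and
   [inr (i, a)] the a-fringe of i.  The pairs (i, a) with [sigma i a <= 0] have
   no fringe in N: they are incident to no arc below. *)
Definition nvertex : finType := ('I_n + 'I_k + 'I_n * 'I_k)%type.

(* Zero exactly on the pairs that are not edges of N. *)
Definition ncap (u v : nvertex) : R :=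
  match u, v with
  | inl (inl i), inl (inl j) => if e i j then lam i j else 0
  | inl (inl i), inl (inr a) | inl (inr a), inl (inl i) =>
      if (0 < mu i) && (gam i == Some a) then mu i else 0
  | inl (inl i), inr (j, a) | inr (j, a), inl (inl i) =>
      if (i == j) && (0 < sigma i a) then 2 * sigma i a else 0
  | _, _ => 0
  end.

Definition narc : finType := (nvertex * nvertex)%type.

Definition arc_cap (a : narc) : R := ncap a.1 a.2.

Variable al : 'I_k.

Definition other_fringe (u : nvertex) : bool :=
  if u is inr (_, b) then b != al else false.

Definition arcs : {set narc} :=
  [set a : narc | [&& 0 < arc_cap a, ~~ other_fringe a.1 & ~~ other_fringe a.2]].

(* Vertices after contraction: [inl i] is the vertex i, [inr true] is s_al and
   [inr false] is s'. *)
Definition cvertex : finType := ('I_n + bool)%type.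
Definition csource : cvertex := inr true.
Definition csink : cvertex := inr false.

(* The value on the removed fringes is irrelevant. *)
Definition contract (u : nvertex) : cvertex :=
  match u with
  | inl (inl i) => inl i
  | inl (inr b) => if b == al then csource else csink
  | inr _ => csink
  end.

Definition csrc (a : narc) : cvertex := contract a.1.
Definition ctgt (a : narc) : cvertex := contract a.2.

Definition max_flow_al (phi : narc -> R) : Prop :=
  is_max_flow arcs csrc ctgt arc_cap csource csink phi.

Definition Galpha (phi : narc -> R) : rel cvertex :=
  residual arcs csrc ctgt arc_cap phi.

(* The components retained contain neither s_al nor s', so that the
   preimage of X under [inl] is X itself, viewed as a subset of V. *)
Definition Sigma (phi : narc -> R) : {set {set 'I_n}} :=
  [set [set i | inl i \in X] | X : {set cvertex} in sccs (Galpha phi) &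
     ~~ [exists x in X, connect (Galpha phi) csource x] &&
     ~~ [exists x in X, connect (Galpha phi) x csink]].

Definition Sigma_le (phi : narc -> R) : rel {set 'I_n} := fun X Y =>
  [exists x in X, exists y in Y, connect (Galpha phi) (inl y) (inl x)].

End Network.

Section Ideals.
Variables (T : finType) (D : {set T}) (le : rel T).

Definition is_ideal (I : {set T}) : bool :=
  (I \subset D) &&
  [forall x in D, forall y in D, (y \in I) && le x y ==> (x \in I)].

Definition ideals : {set {set T}} := [set I | is_ideal I].

Variable inc : rel T.

Definition consistent_ideal (I : {set T}) : bool :=
  is_ideal I && [forall x in I, forall y in I, ~~ inc x y].

Definition max_consistent_ideals : {set {set T}} :=
  [set I | maxset consistent_ideal I].

End Ideals.

Section PIP.
Variables (T : finType) (k : nat).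
Variables (S : 'I_k -> {set T}) (leS : 'I_k -> rel T).

Definition P_set : {set T * 'I_k} := \bigcup_(a < k) setX (S a) [set a].

Definition P_le : rel (T * 'I_k) := fun p q =>
  (p.2 == q.2) && leS p.2 p.1 q.1.

Definition P_inc : rel (T * 'I_k) := fun p q =>
  [&& p.2 != q.2, p.1 == q.1 & p.1 \in S p.2 :&: S q.2].

Definition Sigma2 (a b : 'I_k) : {set T} := S a :&: S b.

Definition Sigma0 (a : 'I_k) : {set T} :=
  S a :\: \bigcup_(b < k | b != a) Sigma2 a b.

Definition R_set : {set T} :=
  \bigcup_(a < k) \bigcup_(b < k | (a < b)%N) Sigma2 a b.

Definition R_le : rel T := fun X Y =>
  [exists a : 'I_k, exists b : 'I_k,
     [&& (a < b)%N, X \in Sigma2 a b, Y \in Sigma2 a b & leS a X Y]].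

Definition bar (J : {set T}) : {set T * 'I_k} :=
  (\bigcup_(a < k) setX (Sigma0 a) [set a]) :|:
  (\bigcup_(a < k) \bigcup_(b < k | (a < b)%N)
     (setX (J :&: Sigma2 a b) [set a] :|: setX (Sigma2 b a :\: J) [set b])).

End PIP.

(* Main.v *)
Require Import Defs.
From mathcomp Require Import all_boot all_order all_algebra.
From mathcomp Require Import reals.
From mathcomp Require Import lra.
Set Implicit Arguments.
Unset Strict Implicit.
Unset Printing Implicit Defensive.
Import Order.TTheory GRing.Theory Num.Theory.
Local Open Scope ring_scope.

(** The proof rests on three facts about the posets [Sigma a]:
    - no set lies in three of them;
    - [Sigma a :&: Sigma b] is closed upwards in [Sigma a];
    - on [Sigma a :&: Sigma b] the orders [a] and [b] are opposite.

    Given these, the components that belong to a single label form a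
    down-closed part of the PIP without inconsistencies, so every maximal
    consistent ideal contains them; on the components shared by [a < b] it
    picks exactly one of the two labels.  That the components with label [a]
    form an ideal for [a] is the same as their complement, with label [b],
    being an ideal for [b], because the orders are opposite.  This is
    [bar_bijective].

    The three facts come from uncrossing.  By max-flow min-cut, the sets closed
    in the residual graph of label [a] are the minimizers of a cut function
    [F a A] = (sum over [A] of [2 * (g_i a - g_i 0)]) + (weight of the edges
    leaving [A]), by [closed_side_minimizer].  Since [g_i a + g_i b >= 2 g_i 0], replacing
    minimizers [A] of [F a] and [B] of [F b] by [A :\: B] and [B :\: A] does not
    increase the sum of the two cut functions.  So the
    differences are minimizers again, the two costs cancel on [A :&: B], and no
    edge joins [A :&: B] to the complement of [A :|: B]
    ([closed_side_uncross]).

    A component in [Sigma a] is an [atom] of the family of closed sets: a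
    difference of two closed sets that every closed set either contains or
    avoids.  In this language the second and third facts follow
    from stability under differences alone ([atom_shared_up],
    [atom_shared_rev]).  For the first, if [X] were an atom for three labels,
    there would be closed sets [A], [B], [C] for them whose pairwise
    intersections all equal [X].  An edge leaving [X] would end in two of them,
    hence in [X]; by connectedness [X] is the whole vertex set, and the
    pairwise cancellation of the three costs makes all of them vanish
    everywhere ([three_atoms_costless]), which the nondegeneracy hypothesis
    excludes. *)

(** * Maximal consistent ideals when shared elements have opposite orders *)

Section MaximalConsistentIdeals.
Variables (T : finType) (k : nat).
Implicit Types (X Y : T) (a b c d : 'I_k) (J : {set T}) (I : {set T * 'I_k}).
Variables (S : 'I_k -> {set T}) (leS : 'I_k -> rel T).

Hypothesis at_most_two : forall X a b c,
  a != b -> a != c -> b != c -> X \in S a -> X \in S b -> X \notin S c.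
Hypothesis shared_up : forall a b X Y,
  a != b -> Y \in S a -> Y \in S b -> X \in S a -> leS a Y X -> X \in S b.
Hypothesis shared_rev : forall a b X Y, a != b ->
  X \in S a -> X \in S b -> Y \in S a -> Y \in S b -> leS a Y X -> leS b X Y.

Lemma shared_unique X a b c :
  a != b -> X \in S a -> X \in S b -> X \in S c -> (c == a) || (c == b).
Proof.
move=> ab Xa Xb; apply: contraTT; rewrite negb_or => /andP[ca cb].
by apply: (@at_most_two X a b c); rewrite // eq_sym.
Qed.

Lemma mem_P_set X c : ((X, c) \in P_set S) = (X \in S c).
Proof.
apply/bigcupP/idP => [[a _]|Xc]; first by rewrite in_setX inE => /andP[? /eqP->].
by exists c => //; rewrite in_setX inE Xc eqxx.
Qed.

Lemma mem_Sigma0 X c :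
  reflect (X \in S c /\ forall b, b != c -> X \notin S b) (X \in Sigma0 S c).
Proof.
rewrite inE andbC; apply: (iffP andP) => [[Xc nX]|[Xc nX]]; split => //.
  move=> b bc; apply: contra nX => Xb.
  by apply/bigcupP; exists b; rewrite // inE Xc.
by apply/bigcupP => -[b bc]; rewrite inE (negPf (nX b bc)) andbF.
Qed.

Lemma mem_bar J X c : ((X, c) \in bar S J) =
  [|| X \in Sigma0 S c,
      [exists b : 'I_k, [&& (c < b)%N, X \in J & X \in Sigma2 S c b]] |
      [exists a : 'I_k, [&& (a < c)%N, X \notin J & X \in Sigma2 S c a]]].
Proof.
rewrite inE; congr (_ || _).
  apply/bigcupP/idP => [[a _]|X0]; first by rewrite in_setX inE => /andP[? /eqP->].
  by exists c => //; rewrite in_setX inE X0 eqxx.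
apply/bigcupP/orP => [[a _ /bigcupP[b ab]]|].
  rewrite in_setU !in_setX !in_set1 /= => /orP[] /andP[XJ /eqP->].
    by left; apply/existsP; exists b; rewrite ab -in_setI.
  by right; apply/existsP; exists a; rewrite ab -in_setD.
case=> /existsP[d /andP[lt]].
  rewrite -in_setI => XJ; exists c => //; apply/bigcupP; exists d => //.
  by rewrite in_setU !in_setX !in_set1 XJ eqxx.
rewrite -in_setD => XJ; exists d => //; apply/bigcupP; exists c => //.
by rewrite in_setU !in_setX !in_set1 XJ eqxx orbT.
Qed.

Lemma mem_bar_shared J X b c : b != c -> X \in S c -> X \in S b ->
  ((X, c) \in bar S J) = if (c < b)%N then X \in J else X \notin J.
Proof.
move=> bc Xc Xb; rewrite mem_bar.
have -> : (X \in Sigma0 S c) = false.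
  by apply/negbTE/negP => /mem_Sigma0[_ /(_ b bc)]; rewrite Xb.
rewrite orFb; have only (d : 'I_k) : (c < d)%N || (d < c)%N -> X \in S d -> d = b.
  move=> dc Xd; apply/eqP; have := shared_unique bc Xb Xc Xd.
  suff /negPf-> : d != c by rewrite orbF.
  by apply: contraTneq dc => ->; rewrite ltnn.
have uniq (d : 'I_k) : (c < d)%N || (d < c)%N -> X \in Sigma2 S c d -> d = b.
  by move=> dc; rewrite inE => /andP[_ /only->].
have Xcb : X \in Sigma2 S c b by rewrite inE Xc.
case: ltnP => cb.
  apply/orP/idP => [[]/existsP[d /and3P[dc XJ Xd]]|XJ]; first by [].
    by move: (dc); rewrite (uniq d) ?dc ?orbT // ltnNge ltnW.
  by left; apply/existsP; exists b; rewrite cb XJ.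
have {}cb : (b < c)%N.
  by rewrite ltn_neqAle cb andbT; apply: contraNneq bc => /val_inj->.
apply/orP/idP => [[]/existsP[d /and3P[dc XJ Xd]]|XJ]; last 2 first.
- by [].
- by right; apply/existsP; exists b; rewrite cb XJ.
by move: (dc); rewrite (uniq d) ?dc // ltnNge ltnW.
Qed.

Lemma mem_bar_private J X c :
  (forall b, b != c -> X \notin S b) -> ((X, c) \in bar S J) = (X \in S c).
Proof.
move=> nX; rewrite mem_bar.
have -> : (X \in Sigma0 S c) = (X \in S c).
  by apply/mem_Sigma0/idP => [[]|].
apply/orP/idP => [[//|/orP[]/existsP[d /and3P[_ _]]]|->]; last by left.
  by rewrite inE => /andP[].
by rewrite inE => /andP[].
Qed.

Lemma shared_or_private X c :
  (exists2 b, b != c & X \in S b) \/ (forall b, b != c -> X \notin S b).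
Proof.
have [/existsP[b /andP[bc Xb]]|] := boolP [exists b, (b != c) && (X \in S b)].
  by left; exists b.
rewrite negb_exists => /forallP H; right=> b bc.
by have := H b; rewrite bc.
Qed.

Lemma bar_sub J X c : (X, c) \in bar S J -> X \in S c.
Proof.
rewrite mem_bar => /or3P[/mem_Sigma0[]//||] /existsP[b] /and3P[_ _];
by rewrite inE => /andP[].
Qed.

Lemma mem_R_set X :
  reflect (exists a, exists2 b : 'I_k, (a < b)%N & (X \in S a) && (X \in S b))
          (X \in R_set S).
Proof.
apply: (iffP bigcupP) => [[a _ /bigcupP[b ab]]|[a [b ab X2]]].
  by rewrite inE; exists a, b.
by exists a => //; apply/bigcupP; exists b; rewrite // inE.
Qed.

Lemma R_leP X Y : reflect
  (exists a, exists2 b : 'I_k, (a < b)%N &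
     [/\ X \in S a, X \in S b, Y \in S a, Y \in S b & leS a X Y])
  (R_le S leS X Y).
Proof.
apply: (iffP existsP) => [[a /existsP[b /and4P[ab]]]|[a [b ab [H1 H2 H3 H4 H5]]]].
  by rewrite !inE => /andP[? ?] /andP[? ?] ?; exists a, b.
by exists a; apply/existsP; exists b; rewrite ab !inE H1 H2 H3 H4.
Qed.

Lemma R_le_set X Y : R_le S leS X Y -> (X \in R_set S) && (Y \in R_set S).
Proof.
case/R_leP => a [b ab [H1 H2 H3 H4 H5]].
by apply/andP; split; apply/mem_R_set; exists a, b; rewrite // ?H1 ?H2 ?H3 ?H4.
Qed.

Lemma idealsP (U : finType) (D : {set U}) (le : rel U) (I : {set U}) :
  reflect (I \subset D /\
           forall x y, x \in D -> y \in D -> y \in I -> le x y -> x \in I)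
          (is_ideal D le I).
Proof.
apply: (iffP andP) => -[ID H]; split => //.
  move=> x y xD yD yI xy.
  by have /forall_inP/(_ x xD)/forall_inP/(_ y yD) := H; rewrite yI xy.
apply/forall_inP => x xD; apply/forall_inP => y yD; apply/implyP => /andP[].
exact: H.
Qed.

Lemma ltn_neq (a b : 'I_k) : (a < b)%N -> b != a.
Proof. by apply: contraTneq => ->; rewrite ltnn. Qed.

(** If [Y] lies below [X] and [Y] is shared with another label [b], then so is
    [X]; both are then governed by [J].  The larger of the two labels takes the
    complement of [J], which is down-closed for the reversed order. *)
Lemma bar_ideal J : is_ideal (R_set S) (R_le S leS) J ->
  is_ideal (P_set S) (P_le leS) (bar S J).
Proof.
move=> /idealsP[JR Jdown]; apply/idealsP; split.
  by apply/subsetP => -[X c] /bar_sub; rewrite mem_P_set.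
move=> [Y c'] [X c]; rewrite !mem_P_set => Yc Xc Xbar /andP[/= /eqP E le].
rewrite {c'}E in Yc le *.
have [[b bc Yb]|nY] := shared_or_private Y c; last by rewrite mem_bar_private.
have cb : c != b by rewrite eq_sym.
have Xb : X \in S b := shared_up cb Yc Yb Xc le.
move: Xbar; rewrite !(mem_bar_shared _ bc) //; case: ltnP => [lt|lt].
  move=> XJ; have Rle : R_le S leS Y X by apply/R_leP; exists c, b.
  have /andP[YR XR] := R_le_set Rle; exact: Jdown Rle.
apply: contra => YJ; have Rle : R_le S leS X Y.
  apply/R_leP; exists b, c => //.
    by rewrite ltn_neqAle lt andbT; apply: contraNneq bc => /val_inj->.
  by split=> //; apply: shared_rev le.
have /andP[XR YR] := R_le_set Rle; exact: Jdown Rle.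
Qed.

Lemma bar_consistent J : is_ideal (R_set S) (R_le S leS) J ->
  consistent_ideal (P_set S) (P_le leS) (P_inc S) (bar S J).
Proof.
move=> Jid; apply/andP; split; first exact: bar_ideal.
apply/forall_inP => -[X a] Xa; apply/forall_inP => -[X' b] X'b.
apply/negP => /and3P[/= ab /eqP E]; rewrite -{}E in X'b *.
rewrite inE => /andP[Sa Sb].
have ba : b != a by rewrite eq_sym.
move: Xa X'b; rewrite (mem_bar_shared _ ba) // (mem_bar_shared _ ab) //.
have [lt|lt|/val_inj E] := ltngtP a b; last by rewrite E eqxx in ab.
  by move=> ->.
by move=> /negPf->.
Qed.

Lemma consistent_disjoint I X a b :
  consistent_ideal (P_set S) (P_le leS) (P_inc S) I -> a != b ->
  X \in S a -> X \in S b -> (X, a) \in I -> (X, b) \notin I.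
Proof.
move=> /andP[_ /forall_inP cI] ab Xa Xb Ia; apply/negP => Ib.
have /forall_inP/(_ _ Ib) := cI _ Ia.
by rewrite /P_inc /= ab eqxx inE Xa Xb.
Qed.

(** An element missing from [bar S J] is the unchosen copy of a shared
    component, and is inconsistent with the chosen copy. *)
Lemma bar_maximal J : is_ideal (R_set S) (R_le S leS) J ->
  bar S J \in max_consistent_ideals (P_set S) (P_le leS) (P_inc S).
Proof.
move=> Jid; rewrite inE; apply/maxsetP; split; first exact: bar_consistent.
move=> I cI sub; apply/eqP; rewrite eqEsubset sub andbT.
apply/subsetP => -[X c] XI.
have Xc : X \in S c.
  have /andP[/idealsP[/subsetP/(_ _ XI)]] := cI.
  by rewrite mem_P_set.
have [[b bc Xb]|nX] := shared_or_private X c; last by rewrite mem_bar_private.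
have cb : c != b by rewrite eq_sym.
have := consistent_disjoint cI cb Xc Xb XI.
apply: contraNT => nbar; apply: (subsetP sub).
move: nbar; rewrite (mem_bar_shared _ bc) // (mem_bar_shared _ cb) //.
have [lt|lt|/val_inj E] := ltngtP c b => //; last by rewrite E eqxx in bc.
by rewrite negbK.
Qed.

(** The inverse of [bar S] on the maximal consistent ideals. *)
Definition lower_trace (I : {set T * 'I_k}) : {set T} :=
  [set X | [exists a : 'I_k, exists b : 'I_k,
     [&& (a < b)%N, X \in S a, X \in S b & (X, a) \in I]]].

Lemma mem_lower_trace I X a b : (a < b)%N -> X \in S a -> X \in S b ->
  (X \in lower_trace I) = ((X, a) \in I).
Proof.
move=> ab Xa Xb; rewrite inE; apply/existsP/idP; last first.
  by move=> XI; exists a; apply/existsP; exists b; rewrite ab Xa Xb.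
case=> a' /existsP[b' /and4P[ab' Xa' Xb' XI]].
suff <- : a' = a by [].
have abN : a != b by rewrite eq_sym ltn_neq.
have only (d : 'I_k) : X \in S d -> (d == a) || (d == b).
  exact: shared_unique.
have /orP[/eqP//|/eqP E] := only a' Xa'.
have /orP[/eqP E'|/eqP E'] := only b' Xb'; move: ab'; rewrite E E'.
  by rewrite ltnNge ltnW.
by rewrite ltnn.
Qed.

Lemma lower_trace_ideal I :
  consistent_ideal (P_set S) (P_le leS) (P_inc S) I ->
  is_ideal (R_set S) (R_le S leS) (lower_trace I).
Proof.
case/andP=> /idealsP[_ down] _; apply/idealsP; split.
  apply/subsetP => X; rewrite inE => /existsP[a /existsP[b /and4P[ab Xa Xb _]]].
  by apply/mem_R_set; exists a, b; rewrite // Xa.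
move=> X Y _ _ YJ /R_leP[a [b ab [Xa Xb Ya Yb le]]].
move: YJ; rewrite !(mem_lower_trace _ ab) // => YI.
by apply: (down _ (Y, a)); rewrite ?mem_P_set // /P_le /= eqxx.
Qed.

(** Consistency is what puts a component that [I] takes with its larger label
    outside [lower_trace I].  The inclusion may be strict: [I] may take a
    shared component with neither label. *)
Lemma sub_bar_lower_trace I :
  consistent_ideal (P_set S) (P_le leS) (P_inc S) I ->
  I \subset bar S (lower_trace I).
Proof.
move=> cI; apply/subsetP => -[X c] XI.
have Xc : X \in S c.
  have /andP[/idealsP[/subsetP/(_ _ XI)]] := cI.
  by rewrite mem_P_set.
have [[b bc Xb]|nX] := shared_or_private X c; last by rewrite mem_bar_private.
have cb : c != b by rewrite eq_sym.
rewrite (mem_bar_shared _ bc) //.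
have [lt|lt|/val_inj E] := ltngtP c b; last by rewrite E eqxx in bc.
  by rewrite (mem_lower_trace _ lt).
by rewrite (mem_lower_trace _ lt) // (consistent_disjoint cI cb).
Qed.

(** Surjectivity: a maximal [I] equals [bar S (lower_trace I)], since the
    latter is a consistent ideal containing it. *)
Lemma bar_bijective :
  {in ideals (R_set S) (R_le S leS) &, injective (bar S)} /\
  [set bar S J | J in ideals (R_set S) (R_le S leS)] =
    max_consistent_ideals (P_set S) (P_le leS) (P_inc S).
Proof.
split.
  have half J J' : is_ideal (R_set S) (R_le S leS) J ->
      bar S J = bar S J' -> J \subset J'.
    move=> /idealsP[/subsetP JR _] E; apply/subsetP => X XJ.
    have /mem_R_set[a [b ab /andP[Xa Xb]]] := JR X XJ.
    have := mem_bar_shared J (ltn_neq ab) Xa Xb.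
    by rewrite E (mem_bar_shared _ (ltn_neq ab)) // ab XJ.
  move=> J J'; rewrite !inE => Jid J'id E; apply/eqP.
  by rewrite eqEsubset !half.
apply/setP => I; apply/imsetP/idP => [[J]|Imax].
  by rewrite inE => Jid ->; apply: bar_maximal.
move: Imax; rewrite inE => /maxsetP[cI Imax].
exists (lower_trace I); first by rewrite inE lower_trace_ideal.
symmetry; apply: Imax; first exact/bar_consistent/lower_trace_ideal.
exact: sub_bar_lower_trace.
Qed.

End MaximalConsistentIdeals.

(** * Atoms of a family of sets *)

Section Atoms.
Variable V : finType.
Implicit Types (L : {set V} -> Prop) (A B C X Y : {set V}).

(** When [L] is the lattice of minimizers of a submodular function, its atoms
    are the parts of its Birkhoff representation. *)
Definition atom L X : Prop :=
  [/\ X != set0, exists A, [/\ L A, X \subset A & L (A :\: X)] &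
      forall B, L B -> X \subset B \/ [disjoint X & B]].

(** The order of the Birkhoff representation. *)
Definition forces L X Y : Prop := forall A, L A -> Y \subset A -> X \subset A.

Lemma disjoint_sub0 X B : X != set0 -> X \subset B -> [disjoint X & B] -> False.
Proof.
case/set0Pn => x xX /subsetP/(_ x xX) xB /disjoint_setI0/setP/(_ x).
by rewrite !inE xX xB.
Qed.

Lemma disjointDr X A B : X \subset A -> [disjoint X & A :\: B] -> X \subset B.
Proof.
move=> /subsetP XA /disjoint_setI0/setP XAB; apply/subsetP => x xX.
by have := XAB x; rewrite !inE xX XA // andbT => /negbFE.
Qed.

Lemma disjointD X A B : X \subset A :\: B -> [disjoint X & B].
Proof. by rewrite subsetD => /andP[]. Qed.

(** The pair [A :\: X], [A] witnessing that [X] is a difference for [La] turns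
    into [B :\: A], [B :\: (A :\: X)] for [Lb]; and if [B'] in [Lb] split [X],
    then [A :\: B'] in [La] would split it too. *)
Lemma atom_transfer La Lb X A B :
  (forall C D, La C -> Lb D -> La (C :\: D)) ->
  (forall C D, La C -> Lb D -> Lb (D :\: C)) ->
  atom La X -> La A -> La (A :\: X) -> X \subset A -> Lb B -> X \subset B ->
  atom Lb X.
Proof.
move=> Dab Dba [X0 _ split] LA LAX XA LB XB; split => //.
  exists (B :\: (A :\: X)); split; first exact: Dba.
    by apply/subsetP => x xX; rewrite !inE xX /= (subsetP XB).
  suff -> : (B :\: (A :\: X)) :\: X = B :\: A by apply: Dba.
  apply/setP => x; rewrite !inE; have := subsetP XA x.
  by do 3 case: (_ \in _) => //=; move=> /(_ isT).
move=> B' LB'; case: (split _ (Dab _ _ LA LB')) => [/disjointD|]; first by right.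
by move/(disjointDr XA); left.
Qed.

(** Removing from [A] a set of [Lb] that contains [Y] yields a set of [La] that
    misses [Y], hence misses [X]: the removed set contains [X]. *)
Lemma atom_shared_up La Lb X Y :
  (forall C D, La C -> Lb D -> La (C :\: D)) ->
  (forall C D, La C -> Lb D -> Lb (D :\: C)) ->
  atom La Y -> atom Lb Y -> atom La X -> forces La Y X -> atom Lb X.
Proof.
move=> Dab Dba _ [Y0 [B [LB YB _]] _] aX YX.
have [X0 [A [LA XA LAX]] split] := aX.
apply: (atom_transfer Dab Dba aX LA LAX XA LB).
case: (split _ (Dab _ _ LA LB)) => [XAB|]; last exact: disjointDr.
by case: (disjoint_sub0 Y0 YB); apply: disjointD (YX _ (Dab _ _ LA LB) XAB).
Qed.

(** Otherwise some [B] of [Lb] contains [Y] and misses [X], and [A :\: B]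
    contains [X] without containing [Y]. *)
Lemma atom_shared_rev La Lb X Y :
  (forall C D, La C -> Lb D -> La (C :\: D)) ->
  atom La X -> atom Lb X -> atom La Y -> forces La Y X -> forces Lb X Y.
Proof.
move=> Dab [_ [A [LA XA _]] _] [_ _ split] [Y0 _ _] YX B LB YB.
case: (split B LB) => // XB; case: (disjoint_sub0 Y0 YB).
apply: disjointD (YX _ (Dab _ _ LA LB) _).
by rewrite subsetD XA.
Qed.

(** Start from arbitrary witnesses and subtract from each one the unwanted
    part [A :\: X] of the previous ones. *)
Lemma atom_three_witnesses La Lb Lc X :
  (forall C D, La C -> Lb D -> Lb (D :\: C)) ->
  (forall C D, La C -> Lc D -> Lc (D :\: C)) ->
  (forall C D, Lb C -> Lc D -> Lc (D :\: C)) ->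
  atom La X -> atom Lb X -> atom Lc X ->
  exists A B C, [/\ [/\ La A, Lb B & Lc C],
    A :&: B = X, A :&: C = X & B :&: C = X].
Proof.
move=> Dab Dac Dbc [_ [A [LA XA LAX]] _] [_ [B [LB XB LBX]] _] [_ [C [LC XC LCX]] _].
exists A, (B :\: (A :\: X)), (C :\: (A :\: X) :\: (B :\: X)); split.
  by split=> //; [apply: Dab|apply: Dbc => //; apply: Dac].
all: apply/setP => x; move: (subsetP XA x) (subsetP XB x) (subsetP XC x);
  by rewrite !inE; case: (x \in X) => [/(_ isT) xA /(_ isT) xB /(_ isT) xC|_ _ _];
    rewrite ?xA ?xB ?xC //; case: (x \in A) (x \in B) (x \in C) => [] [] [].
Qed.

End Atoms.

(** * Strongly connected components between source and sink *)

Section ResidualComponents.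
Variables (V : finType) (r : rel (V + bool)).
Implicit Types (A B X Y : {set V}).

Local Notation s := (inr true : V + bool).
Local Notation t := (inr false : V + bool).

(** [inr true] is the source and [inr false] the sink, so [inr b] lies on the
    source side exactly when [b] holds. *)
Definition side A : {set V + bool} :=
  [set z | match z with inl i => i \in A | inr b => b end].

Definition closed_side A : Prop :=
  forall x y, x \in side A -> r x y -> y \in side A.

Definition inner_components : {set {set V}} :=
  [set [set i | inl i \in Z] | Z : {set V + bool} in sccs r &
     ~~ [exists x in Z, connect r s x] && ~~ [exists x in Z, connect r x t]].

Lemma mem_side_inl A i : (inl i \in side A) = (i \in A).
Proof. by rewrite inE. Qed.

Lemma mem_side_inr A b : (inr b \in side A) = b.
Proof. by rewrite inE. Qed.

Lemma closed_side_connect A x y :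
  closed_side A -> x \in side A -> connect r x y -> y \in side A.
Proof.
move=> clA xA /connectP[p]; elim: p x xA => [|z p IH] x xA /=; first by move=> _ ->.
by case/andP=> xz; apply: IH; apply: clA xz.
Qed.

Lemma closed_side_source A i : closed_side A -> connect r s (inl i) -> i \in A.
Proof.
by move=> clA /(closed_side_connect clA); rewrite mem_side_inl mem_side_inr; apply.
Qed.

Lemma closed_side_sink A i : closed_side A -> i \in A -> ~~ connect r (inl i) t.
Proof.
move=> clA iA; apply/negP => /(closed_side_connect clA).
by rewrite mem_side_inl mem_side_inr iA => /(_ isT).
Qed.

Hypothesis no_st : ~~ connect r s t.

(** The least candidate for a closed side containing [X]; it is one unless [X]
    reaches the sink. *)
Definition reach X : {set V} :=
  [set i | connect r s (inl i) || [exists x in X, connect r (inl x) (inl i)]].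

Lemma reach_sub X : X \subset reach X.
Proof.
apply/subsetP => x xX; rewrite inE; apply/orP; right.
by apply/exists_inP; exists x.
Qed.

Lemma reach_closed X :
  (forall x, x \in X -> ~~ connect r (inl x) t) -> closed_side (reach X).
Proof.
move=> Xt u v uX uv.
have {uX} : connect r s u \/ exists2 x, x \in X & connect r (inl x) u.
  case: u uX {uv} => [i|[]]; last by rewrite mem_side_inr.
    by rewrite mem_side_inl inE => /orP[|/exists_inP]; [left|right].
  by left; apply: connect0.
have uv' := connect1 uv.
case: v {uv} uv' => [j|[]] uv su; last first.
- case: su => [su|[x xX xu]]; first by case/negP: no_st; apply: connect_trans uv.
  by move: (Xt x xX); rewrite (connect_trans xu uv).
- by rewrite mem_side_inr.
rewrite mem_side_inl inE; apply/orP; case: su => [su|[x xX xu]].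
  by left; apply: connect_trans su uv.
by right; apply/exists_inP; exists x; last apply: connect_trans xu uv.
Qed.

(** The component of [i0] is the difference between what is reachable from
    [i0] or the source, and the part of this that cannot get back to [i0]. *)
Lemma inner_component_atom X : X \in inner_components -> atom closed_side X.
Proof.
case/imsetP => Z; rewrite inE => /andP[/imsetP[z0 _ ->]].
have z0Z : z0 \in [set y in [set: V + bool] | connect r z0 y && connect r y z0].
  by rewrite !inE connect0.
case/andP=> /exists_inPn/(_ _ z0Z) sz /exists_inPn/(_ _ z0Z) zt.
case: z0 {z0Z} sz zt => [i0|[]] sz zt ->; last 2 first.
- by rewrite connect0 in sz.
- by rewrite connect0 in zt.
set X0 := [set _ | _].
have XE i : (i \in X0) = connect r (inl i0) (inl i) && connect r (inl i) (inl i0).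
  by rewrite !inE.
have i0X : i0 \in X0 by rewrite XE connect0.
have XA : X0 \subset reach [set i0].
  apply/subsetP => i; rewrite XE => /andP[h _]; rewrite inE; apply/orP; right.
  by apply/exists_inP; exists i0; rewrite ?set11.
have clA : closed_side (reach [set i0]).
  by apply: reach_closed => x /set1P->.
split; first by apply/set0Pn; exists i0.
- exists (reach [set i0]); split=> // u v uAX uv.
  have uA : u \in side (reach [set i0]).
    by case: u uAX {uv} => [i|b]; rewrite ?mem_side_inr // !mem_side_inl inE => /andP[].
  have := clA _ _ uA uv.
  case: v uv => [j|b] uv; rewrite ?mem_side_inr // !mem_side_inl => jA.
  rewrite inE jA andbT; apply/negP; rewrite XE => /andP[_ ji0].
  have ui0 := connect_trans (connect1 uv) ji0.
  case: u uAX uA ui0 {uv} => [i|[]]; rewrite ?mem_side_inr // ?mem_side_inl.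
    move=> iAX iA ii0; move: iAX iA.
    rewrite !in_setD XE ii0 andbT inE => /andP[ni0 _] /orP[si|].
      by rewrite (connect_trans si ii0) in sz.
    by case/exists_inP => _ /set1P-> h; rewrite h in ni0.
  by move=> _ _ si0; rewrite si0 in sz.
move=> B clB; have [iB|iB] := boolP (i0 \in B); [left|right].
  apply/subsetP => j; rewrite XE => /andP[h _].
  by have := closed_side_connect clB _ h; rewrite !mem_side_inl; apply.
rewrite disjoint_subset; apply/subsetP => j; rewrite XE => /andP[_ h].
apply: contra iB => jB.
by have := closed_side_connect clB _ h; rewrite !mem_side_inl; apply.
Qed.

(** For [x], [i] in [X], the closed set [reach [set x]] meets [X], hence
    contains [i]; as [i] is not reachable from the source, it is
    reachable from [x]. *)
Lemma atom_inner_component X : atom closed_side X -> X \in inner_components.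
Proof.
case=> /set0Pn[x0 x0X] [A [clA XA clAX]] split.
have x0A := subsetP XA _ x0X.
have sX x : x \in X -> ~~ connect r s (inl x).
  move=> xX; apply/negP => /(closed_side_source clAX).
  by rewrite inE xX.
have clR : closed_side (reach [set x0]).
  by apply: reach_closed => x /set1P->; apply: closed_side_sink clA _.
have XR : X \subset reach [set x0].
  case: (split _ clR) => // /disjoint_setI0/setP/(_ x0).
  by rewrite in_setI x0X (subsetP (reach_sub _)) ?in_set0 ?set11.
pose Z := [set y in [set: V + bool] | connect r (inl x0) y && connect r y (inl x0)].
have -> : X = [set i | inl i \in Z].
  apply/setP => i; rewrite !inE /=.
  have fromx0 j : j \in X -> connect r (inl x0) (inl j).
    move=> jX; have := subsetP XR _ jX; rewrite inE (negPf (sX _ jX)) /=.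
    by case/exists_inP => _ /set1P->.
  apply/idP/andP => [iX|[x0i ix0]].
    split; first exact: fromx0.
    have clRi : closed_side (reach [set i]).
      by apply: reach_closed => x /set1P->; apply/(closed_side_sink clA)/(subsetP XA).
    case: (split _ clRi) => [/subsetP/(_ _ x0X)|/disjoint_setI0/setP/(_ i)].
      by rewrite inE (negPf (sX _ x0X)) => /exists_inP[_ /set1P->].
    by rewrite in_setI iX (subsetP (reach_sub _)) ?in_set0 ?set11.
  have iA : i \in A.
    by have := closed_side_connect clA _ x0i; rewrite !mem_side_inl; apply.
  apply/negPn/negP => iX; have := closed_side_connect clAX _ ix0.
  by rewrite !mem_side_inl !in_setD iA iX x0X => /(_ isT).
apply/imsetP; exists Z => //; rewrite inE; apply/andP; split.
  by apply/imsetP; exists (inl x0).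
apply/andP; split; apply/exists_inPn => z; rewrite !inE => /and3P[_ x0z zx0].
  by apply: contra (sX _ x0X) => sz; apply: connect_trans sz zx0.
apply: contra (closed_side_sink clA x0A) => zt; exact: connect_trans x0z zt.
Qed.

Lemma reachable_forces X Y : atom closed_side X ->
  [exists x in X, exists y in Y, connect r (inl y) (inl x)] ->
  forces closed_side X Y.
Proof.
move=> [_ _ split] /exists_inP[x xX /exists_inP[y yY yx]] A clA YA.
case: (split A clA) => // /disjoint_setI0/setP/(_ x).
have := closed_side_connect clA _ yx.
by rewrite !mem_side_inl (subsetP YA) // => /(_ isT) xA; rewrite !inE xX xA.
Qed.

Lemma forces_reachable X Y : atom closed_side X -> atom closed_side Y ->
  forces closed_side X Y ->
  [exists x in X, exists y in Y, connect r (inl y) (inl x)].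
Proof.
move=> [/set0Pn[x xX] [A [clA XA clAX]] _] [_ [B [clB YB _]] _] XY.
have clR : closed_side (reach Y).
  by apply: reach_closed => y /(subsetP YB); apply: closed_side_sink.
have /subsetP/(_ x xX) := XY _ clR (reach_sub Y).
rewrite inE => /orP[/(closed_side_source clAX)|h]; first by rewrite inE xX.
by apply/exists_inP; exists x.
Qed.

End ResidualComponents.

(** * Maximum flows and minimum cuts *)

Section MaxFlowMinCut.
Variables (R : realType) (Arc W : finType) (A : {set Arc}).
Variables (src tgt : Arc -> W) (c : Arc -> R) (s t : W).
Implicit Types (phi d : Arc -> R) (S : {set W}).

Definition net d (z : W) : R :=
  \sum_(a in A | src a == z) d a - \sum_(a in A | tgt a == z) d a.

Definition cut_cap S : R := \sum_(a in A | (src a \in S) && (tgt a \notin S)) c a.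

Local Notation res := (residual A src tgt c).

(** Directions in which a small step respects the capacities.  They form a
    convex cone, so that directions along consecutive residual arcs can be
    added even when they use the same arc. *)
Definition admissible phi d : Prop :=
  forall a, a \in A -> (0 < d a -> phi a < c a) /\ (d a < 0 -> 0 < phi a).

Lemma net_combine phi d e z :
  net (fun a => phi a + e * d a) z = net phi z + e * net d z.
Proof. by rewrite /net !big_split /= -!mulr_sumr; lra. Qed.

Lemma net_unit a z : a \in A ->
  net (fun b => (b == a)%:R) z = (src a == z)%:R - (tgt a == z)%:R.
Proof.
move=> aA; have one (f : Arc -> W) :
    \sum_(b in A | f b == z) ((b == a)%:R : R) = (f a == z)%:R.
  have [fa|fa] := eqVneq (f a) z.
    rewrite (bigD1 a) ?aA ?fa ?eqxx //= big1 ?addr0 //.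
    by move=> b /andP[_ /negPf->].
  rewrite big1 // => b /andP[_ /eqP fb]; have [E|//] := eqVneq b a.
  by rewrite -fb E eqxx in fa.
by rewrite /net !one.
Qed.

(** A unit of flow sent along a residual walk. *)
Lemma connect_direction phi x y : connect (res phi) x y ->
  exists2 d, admissible phi d & forall z, net d z = (x == z)%:R - (y == z)%:R.
Proof.
case/connectP => p; elim: p x => [|w p IH] x /= => [_ ->|/andP[xw pw] lastp].
  exists (fun _ => 0) => [a _|z]; first by rewrite ltxx.
  by rewrite /net !big1 // !subrr.
have [d adm netd] := IH w pw lastp.
case/exists_inP: xw => a aA /orP[] /and3P[/eqP src_a /eqP tgt_a lt].
  exists (fun b => d b + 1 * (b == a)%:R) => [b bA|z].
    have [H1 H2] := adm b bA; have [E|_] := eqVneq b a; last by rewrite mulr0 addr0.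
    subst b; rewrite /= mulr1n; split=> // h; apply: H2; lra.
  by rewrite net_combine netd net_unit // src_a tgt_a; lra.
exists (fun b => d b + (-1) * (b == a)%:R) => [b bA|z].
  have [H1 H2] := adm b bA; have [E|_] := eqVneq b a; last by rewrite mulr0 addr0.
  subst b; rewrite /= mulr1n; split=> // h; apply: H1; lra.
by rewrite net_combine netd net_unit // src_a tgt_a; lra.
Qed.

Lemma admissible_step phi d : (forall a, a \in A -> 0 <= phi a <= c a) ->
  admissible phi d ->
  exists2 e : R, 0 < e & forall a, a \in A -> 0 <= phi a + e * d a <= c a.
Proof.
move=> capphi adm.
pose room a : R := if 0 < d a then (c a - phi a) / d a
                   else if d a < 0 then phi a / - d a else 1.
have room_gt0 a : a \in A -> 0 < room a.
  move=> aA; have [H1 H2] := adm a aA; rewrite /room.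
  case: ifP => [da|_]; first by rewrite divr_gt0 // subr_gt0 H1.
  by case: ifP => // da; rewrite divr_gt0 ?oppr_gt0 // H2.
have e_gt0 : 0 < \big[Num.min/1]_(a in A) room a by apply: lt_bigmin.
exists (\big[Num.min/1]_(a in A) room a) => // a aA.
set e := \big[_/_]_(_ in _) _ in e_gt0 *; have e0 := ltW e_gt0.
have /andP[phi0 phic] := capphi a aA.
have : e <= room a by apply: bigmin_le_cond.
rewrite /room; case: ltgtP => [da|da|<-] le; last by rewrite mulr0 addr0 phi0.
  move: le; rewrite ler_pdivlMr // => le.
  have := mulr_ge0 e0 (ltW da); lra.
move: le; rewrite ler_pdivlMr ?oppr_gt0 // => le.
have := mulr_ge0 e0 (_ : 0 <= - d a); rewrite oppr_ge0 => /(_ (ltW da)); lra.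
Qed.

Lemma net_flow phi x : is_flow A src tgt c s t phi -> x != s -> x != t ->
  net phi x = 0.
Proof. by move=> [_ cons] xs xt; rewrite /net cons // subrr. Qed.

Lemma max_flow_no_augmenting phi : s != t ->
  is_max_flow A src tgt c s t phi -> ~~ connect (res phi) s t.
Proof.
move=> st [flow maxphi]; apply/negP => /connect_direction[d adm netd].
have [e e0 cape] := admissible_step flow.1 adm.
have {}flow : is_flow A src tgt c s t (fun a => phi a + e * d a).
  split=> // x xs xt; apply/esym/eqP; rewrite -subr_eq0 -/(net _ x).
  rewrite net_combine netd (net_flow flow) //.
  by rewrite (eq_sym s) (negPf xs) (eq_sym t) (negPf xt) subrr mulr0 addr0.
have := maxphi _ flow; rewrite /flow_value -!/(net _ s) net_combine netd eqxx.
by rewrite (eq_sym t) (negPf st) subr0 mulr1 gerDl leNgt e0.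
Qed.

Lemma sum_over_side (f : Arc -> W) (d : Arc -> R) S :
  \sum_(z in S) \sum_(a in A | f a == z) d a = \sum_(a in A | f a \in S) d a.
Proof.
rewrite (exchange_big_dep (mem A)) /= => [|? ? _ /andP[]//].
rewrite [RHS]big_mkcondr /=; apply: eq_bigr => a aA.
case: ifP => faS; last first.
  by rewrite big1 // => z; rewrite aA => /andP[zS /eqP E]; rewrite E zS in faS.
rewrite (big_pred1 (f a)) // => z; rewrite aA /= eq_sym.
by have [->|] := eqVneq; rewrite ?faS ?andbF.
Qed.

Lemma flow_value_cut phi S : is_flow A src tgt c s t phi ->
  s \in S -> t \notin S ->
  flow_value A src tgt s phi =
    \sum_(a in A | (src a \in S) && (tgt a \notin S)) phi a -
    \sum_(a in A | (src a \notin S) && (tgt a \in S)) phi a.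
Proof.
move=> flow sS tS; rewrite /flow_value -/(net phi s).
have -> : net phi s = \sum_(z in S) net phi z.
  rewrite (bigD1 s) //= big1 ?addr0 // => z /andP[zS zs].
  by apply: net_flow => //; apply: contraNneq tS => <-.
rewrite sumrB !sum_over_side.
rewrite (bigID (fun a => tgt a \in S)) [X in _ - X](bigID (fun a => src a \in S)) /=.
rewrite [X in _ - (X + _)](eq_bigl
  (fun a => (a \in A) && (src a \in S) && (tgt a \in S))); last first.
  by move=> a; rewrite andbAC.
rewrite opprD addrACA subrr add0r; congr (_ - _); apply: eq_bigl => a;
by rewrite ?[in RHS]andbA // andbAC.
Qed.

Lemma cut_slack phi S : is_flow A src tgt c s t phi ->
  s \in S -> t \notin S ->
  cut_cap S - flow_value A src tgt s phi =
    \sum_(a in A | (src a \in S) && (tgt a \notin S)) (c a - phi a) +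
    \sum_(a in A | (src a \notin S) && (tgt a \in S)) phi a.
Proof.
by move=> flow sS tS; rewrite (flow_value_cut flow sS tS) sumrB /cut_cap; lra.
Qed.

Lemma flow_value_le_cut phi S : is_flow A src tgt c s t phi ->
  s \in S -> t \notin S -> flow_value A src tgt s phi <= cut_cap S.
Proof.
move=> flow sS tS; rewrite -subr_ge0 (cut_slack flow) // addr_ge0 //;
apply: sumr_ge0 => a /andP[aA _]; case/andP: (flow.1 a aA) => //.
by rewrite subr_ge0.
Qed.

(** The slack of a cut is a sum of nonnegative terms, one per arc across it;
    the term of an arc vanishes exactly when the arc gives no residual arc
    leaving [S]. *)
Lemma tight_cutP phi S : is_flow A src tgt c s t phi ->
  s \in S -> t \notin S ->
  (forall x y, x \in S -> res phi x y -> y \in S) <->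
  cut_cap S = flow_value A src tgt s phi.
Proof.
move=> flow sS tS; split=> [clS|/eqP].
  apply/eqP; rewrite -subr_eq0 (cut_slack flow) //.
  rewrite big1 ?add0r => [|a /and3P[aA sa ta]]; last first.
    apply: contraNeq ta => ne; apply: clS sa _; apply/exists_inP; exists a => //.
    by rewrite !eqxx /= -subr_gt0 lt_def ne subr_ge0; case/andP: (flow.1 a aA) => _ ->.
  rewrite big1 // => a /and3P[aA sa ta].
  apply: contraNeq sa => ne; apply: clS ta _; apply/exists_inP; exists a => //.
  by rewrite !eqxx /= [0 < _]lt_def ne; case/andP: (flow.1 a aA) => -> _; rewrite orbT.
rewrite -subr_eq0 (cut_slack flow) // paddr_eq0; last 2 first.
- by apply: sumr_ge0 => a /andP[aA _]; case/andP: (flow.1 a aA); rewrite subr_ge0.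
- by apply: sumr_ge0 => a /andP[aA _]; case/andP: (flow.1 a aA).
case/andP=> /eqP out0 /eqP in0 x y xS /exists_inP[a aA].
have /andP[phi0 phic] := flow.1 a aA.
case/orP=> /and3P[/eqP sa /eqP ta lt]; apply/negPn/negP => yS.
  have := psumr_eq0P _ out0 (i := a); rewrite sa ta aA xS yS => /(_ _ isT) E.
  suff : c a - phi a = 0 by lra.
  by apply: E => b /andP[bA _]; case/andP: (flow.1 b bA); rewrite subr_ge0.
have := psumr_eq0P _ in0 (i := a); rewrite sa ta aA xS yS => /(_ _ isT) E.
suff : phi a = 0 by lra.
by apply: E => b /andP[bA _]; case/andP: (flow.1 b bA).
Qed.

End MaxFlowMinCut.

(** * Uncrossing two cut functions *)

Section CutFunction.
Variables (R : realType) (V : finType) (w : V -> V -> R).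
Hypothesis w_sym : forall i j, w i j = w j i.
Implicit Types (A B : {set V}) (u v : V -> R).

Definition cut_fun u A : R :=
  \sum_(i in A) u i + \sum_(i in A) \sum_(j | j \notin A) w i j.

(** Used to compare cut functions: only the symmetric part of the
    coefficients of [w] matters. *)
Lemma sum_antisym0 (h : V -> V -> R) : (forall i j, h i j + h j i = 0) ->
  \sum_i \sum_j w i j * h i j = 0.
Proof.
move=> anti; set s := LHS; suff : s + s = 0 by lra.
rewrite {2}/s exchange_big -big_split big1 // => i _ /=.
rewrite -big_split big1 // => j _ /=.
by rewrite (w_sym j i) -mulrDr anti mulr0.
Qed.

Lemma cut_weight_indicator (P Q : pred V) :
  \sum_(i | P i) \sum_(j | Q j) w i j =
  \sum_i \sum_j w i j * (P i && Q j)%:R.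
Proof.
rewrite big_mkcond; apply: eq_bigr => i _; rewrite big_mkcond /=.
case: (P i); last by rewrite big1 // => j _; rewrite mulr0.
by apply: eq_bigr => j _; case: (Q j); rewrite ?mulr1 ?mulr0.
Qed.

(** Posimodularity of the cut function, in exact form: the edges between
    [A :&: B] and the complement of [A :|: B] are cut twice on the left, and not
    at all by the differences. *)
Lemma cut_fun_uncross u v A B :
  cut_fun u A + cut_fun v B =
    cut_fun u (A :\: B) + cut_fun v (B :\: A) +
    (\sum_(i in A :&: B) (u i + v i) +
     2 * \sum_(i in A :&: B) \sum_(j | j \notin A :|: B) w i j).
Proof.
rewrite /cut_fun (big_setID B u) (big_setID A v) /= (setIC B A) big_split /=.
have : \sum_i \sum_j w i j *
    (((i \in A) && (j \notin A))%:R + ((i \in B) && (j \notin B))%:R -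
     ((i \in A :\: B) && (j \notin A :\: B))%:R -
     ((i \in B :\: A) && (j \notin B :\: A))%:R -
     2 * ((i \in A :&: B) && (j \notin A :|: B))%:R) = 0.
  apply: sum_antisym0 => i j; rewrite !inE.
  by case: (i \in A); case: (i \in B); case: (j \in A); case: (j \in B);
     rewrite /=; lra.
set s := LHS => s0; rewrite !cut_weight_indicator.
have : s = \sum_i \sum_j w i j * ((i \in A) && (j \notin A))%:R +
    \sum_i \sum_j w i j * ((i \in B) && (j \notin B))%:R -
    \sum_i \sum_j w i j * ((i \in A :\: B) && (j \notin A :\: B))%:R -
    \sum_i \sum_j w i j * ((i \in B :\: A) && (j \notin B :\: A))%:R -
    2 * \sum_i \sum_j w i j * ((i \in A :&: B) && (j \notin A :|: B))%:R.
  rewrite mulr_sumr -big_split -!sumrB; apply: eq_bigr => i _ /=.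
  rewrite mulr_sumr -big_split -!sumrB; apply: eq_bigr => j _ /=.
  by rewrite !mulrDr !mulrN (mulrCA _ 2).
rewrite s0; lra.
Qed.

Hypothesis w_ge0 : forall i j, 0 <= w i j.

(** By minimality, the nonnegative defect in [cut_fun_uncross] is zero, hence
    so is each of its terms. *)
Lemma cut_fun_uncross_min u v A B : (forall i, 0 <= u i + v i) ->
  (forall C, cut_fun u A <= cut_fun u C) ->
  (forall C, cut_fun v B <= cut_fun v C) ->
  [/\ forall C, cut_fun u (A :\: B) <= cut_fun u C,
      forall C, cut_fun v (B :\: A) <= cut_fun v C,
      forall i, i \in A :&: B -> u i + v i = 0 &
      forall i j, i \in A :&: B -> j \notin A :|: B -> w i j = 0].
Proof.
move=> uv Amin Bmin; have E := cut_fun_uncross u v A B.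
have := Amin (A :\: B); have := Bmin (B :\: A).
have inner0 i : 0 <= \sum_(j | j \notin A :|: B) w i j by apply: sumr_ge0.
have uv0 : 0 <= \sum_(i in A :&: B) (u i + v i) by apply: sumr_ge0.
have w0 : 0 <= \sum_(i in A :&: B) \sum_(j | j \notin A :|: B) w i j.
  by apply: sumr_ge0.
move=> le1 le2; split.
- by move=> C; apply: le_trans (Amin C); lra.
- by move=> C; apply: le_trans (Bmin C); lra.
- have uv_eq0 : \sum_(i in A :&: B) (u i + v i) = 0 by lra.
  by move=> i; apply: psumr_eq0P uv_eq0 i.
have w_eq0 : \sum_(i in A :&: B) \sum_(j | j \notin A :|: B) w i j = 0 by lra.
have w_i_eq0 := psumr_eq0P (fun i _ => inner0 i) w_eq0.
by move=> i j iAB; apply: psumr_eq0P (w_i_eq0 i iAB) j.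
Qed.

End CutFunction.

(** * Cut capacities of the Potts network *)

Section PottsNetwork.
Variables (R : realType) (k n : nat) (e : rel 'I_n).
Variables (lam : 'I_n -> 'I_n -> R) (gi : 'I_n -> Sk k -> R).
Variable gam : 'I_n -> Sk k.
Implicit Types (i j : 'I_n) (a b : 'I_k) (A B : {set 'I_n}).

Hypothesis lam_pos : forall i j, e i j -> 0 < lam i j.
Hypothesis lam_sym : forall i j, e i j -> lam i j = lam j i.
Hypothesis e_sym : symmetric e.
Hypothesis gi_ksub : forall i a b, a != b ->
  2 * gi i None <= gi i (Some a) + gi i (Some b).
Hypothesis gam_min : forall i x, gi i (gam i) <= gi i x.

Definition weight i j : R := if e i j then lam i j else 0.

Definition label_cost a i : R := 2 * (gi i (Some a) - gi i None).

Local Notation cap := (ncap e lam gi gam).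

Lemma weight_ge0 i j : 0 <= weight i j.
Proof. by rewrite /weight; case: ifP => // /lam_pos/ltW. Qed.

Lemma weight_sym i j : weight i j = weight j i.
Proof. by rewrite /weight e_sym; case: ifP => // /lam_sym. Qed.

Definition terminal_cap i b : R :=
  if (0 < mu gi gam i) && (gam i == Some b) then mu gi gam i else 0.

Definition fringe_cap i a : R :=
  if 0 < sigma gi gam i a then 2 * sigma gi gam i a else 0.

Lemma ncap_ge0 x y : 0 <= cap x y.
Proof.
case: x y => [[i|a]|[i a]] [[j|b]|[j b]] //=; try exact: weight_ge0;
case: ifP => // /andP[h1 h2]; first [exact: ltW | exact/mulr_ge0/ltW].
Qed.

(** If [gam i = Some a], then [i] is joined to the source only, by an edge of
    capacity [mu i]; otherwise it is joined to the sink only, with total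
    capacity [mu i + 2 * sigma i a].  In the second case [sigma i a] is
    nonnegative, by [k]-submodularity if [gam i] is a label and by minimality
    if it is 0. *)
Lemma label_costE i a :
  \sum_(b | b != a) terminal_cap i b + fringe_cap i a - terminal_cap i a =
  label_cost a i.
Proof.
have mu_ge0 : 0 <= mu gi gam i by rewrite mulr_ge0 // subr_ge0.
have termE b : terminal_cap i b = if gam i == Some b then mu gi gam i else 0.
  rewrite /terminal_cap; case: eqP; rewrite ?andbF // andbT.
  by case: ltgtP mu_ge0 => // ->.
have gle := gam_min i (Some a).
have [gia|gia] := eqVneq (gam i) (Some a).
  rewrite big1 => [|b ba]; last first.
    by rewrite termE gia; case: eqP => // -[E]; rewrite E eqxx in ba.
  rewrite termE gia eqxx /fringe_cap; have := gam_min i None.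
  rewrite /sigma /mu /label_cost gia; case: ifP; lra.
rewrite [terminal_cap i a]termE (negPf gia) subr0.
have -> : \sum_(b | b != a) terminal_cap i b = mu gi gam i.
  case E : (gam i) => [b|].
    rewrite E in gia; have ba : b != a by apply: contraNneq gia => ->.
    rewrite (bigD1 b) //= termE E eqxx big1 ?addr0 // => c /andP[_ cb].
    by rewrite termE E; case: eqP => // -[E']; rewrite E' eqxx in cb.
  rewrite big1 => [|b _]; first by rewrite /mu E subrr mulr0.
  by rewrite termE E.
have sig0 : 0 <= sigma gi gam i a.
  rewrite /sigma; case E : (gam i) gia gle => [b|] gia gle; last by lra.
  have /(gi_ksub i) : a != b by apply: contraNneq gia => ->.
  lra.
have -> : fringe_cap i a = 2 * sigma gi gam i a.
  by rewrite /fringe_cap; case: ltgtP sig0 => // <-; rewrite mulr0.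
rewrite /mu /sigma /label_cost; lra.
Qed.

Lemma sum_nvertex (F : nvertex k n -> R) :
  \sum_x F x = \sum_i F (inl (inl i)) + \sum_b F (inl (inr b)) + \sum_p F (inr p).
Proof. by rewrite big_sumType /= big_sumType. Qed.

(** The constant is the total capacity at the source: moving [i] to
    the source side saves its source edge and pays for its sink edges. *)
Lemma cut_cap_network a : exists K : R, forall A,
  cut_cap (arcs e lam gi gam a) (csrc a) (ctgt a) (arc_cap e lam gi gam) (side A)
    = K + cut_fun weight (label_cost a) A.
Proof.
exists (\sum_i terminal_cap i a) => A.
(* Extended by zero to all pairs of vertices, the cut splits by the kinds of
   the two endpoints. *)
pose F x y : R := if [&& ~~ other_fringe a x, ~~ other_fringe a y,
    contract a x \in side A & contract a y \notin side A] then cap x y else 0.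
have -> : cut_cap (arcs e lam gi gam a) (csrc a) (ctgt a)
    (arc_cap e lam gi gam) (side A) = \sum_x \sum_y F x y.
  rewrite pair_bigA /cut_cap big_mkcond /=; apply: eq_bigr => -[x y] _ /=.
  rewrite inE /csrc /ctgt /arc_cap /F /=; have := ncap_ge0 x y.
  rewrite le_eqVlt => /predU1P[<-|->]; first by rewrite !if_same.
  by rewrite /= -!andbA.
rewrite sum_nvertex [X in _ + X]big1 ?addr0; last first.
  move=> p _; rewrite big1 // => y _.
  by rewrite /F; case: ifP => // /and4P[_ _]; rewrite inE.
have -> : \sum_b \sum_y F (inl (inr b)) y = \sum_(i | i \notin A) terminal_cap i a.
  rewrite (bigD1 a) //= [X in _ + X]big1 ?addr0; last first.
    move=> b ba; rewrite big1 // => y _.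
    by rewrite /F; case: ifP => // /and4P[_ _]; rewrite /= (negPf ba) inE.
  rewrite sum_nvertex [X in _ + X]big1 ?addr0; last by move=> p _; rewrite /F if_same.
  rewrite [X in _ + X]big1 ?addr0; last by move=> b _; rewrite /F if_same.
  rewrite [RHS]big_mkcond; apply: eq_bigr => i _.
  by rewrite /F /= eqxx mem_side_inr mem_side_inl.
have inner i : \sum_y F (inl (inl i)) y = if i \in A then
    \sum_(j | j \notin A) weight i j + \sum_(b | b != a) terminal_cap i b +
      fringe_cap i a else 0.
  case: ifP => iA; last first.
    by rewrite big1 // => y _; rewrite /F; case: ifP => // /and4P[_ _]; rewrite mem_side_inl iA.
  rewrite sum_nvertex; congr (_ + _ + _).
  - rewrite [RHS]big_mkcond; apply: eq_bigr => j _.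
    by rewrite /F /= !mem_side_inl iA.
  - rewrite [RHS]big_mkcond; apply: eq_bigr => b _.
    by rewrite /F /= mem_side_inl iA; case: (b == a); rewrite mem_side_inr.
  rewrite (bigD1 (i, a)) //= big1 ?addr0 => [|[j b]].
    by rewrite /F /= eqxx mem_side_inl mem_side_inr iA eqxx.
  rewrite /F /=; have [->|] := eqVneq b a; last by [].
  have [->|ij] := eqVneq i j; first by rewrite eqxx.
  by rewrite if_same.
under eq_bigr do rewrite inner.
rewrite -big_mkcond /= (bigID (mem A) predT) /=.
under eq_bigr do rewrite -addrA.
rewrite big_split /= /cut_fun.
under [X in _ = _ + (X + _)]eq_bigr do rewrite -label_costE.
rewrite sumrB; lra.
Qed.

End PottsNetwork.

(** * Components shared by several labels *)

Section PottsComponents.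
Variables (R : realType) (k n : nat) (e : rel 'I_n).
Variables (lam : 'I_n -> 'I_n -> R) (gi : 'I_n -> Sk k -> R).
Variable gam : 'I_n -> Sk k.
Variable phi : 'I_k -> narc k n -> R.
Implicit Types (a b c : 'I_k) (A B C X Y : {set 'I_n}).

Hypothesis lam_pos : forall i j, e i j -> 0 < lam i j.
Hypothesis lam_sym : forall i j, e i j -> lam i j = lam j i.
Hypothesis e_sym : symmetric e.
Hypothesis e_conn : forall i j, connect e i j.
Hypothesis gi_ksub : forall i a b, a != b ->
  2 * gi i None <= gi i (Some a) + gi i (Some b).
Hypothesis gam_min : forall i x, gi i (gam i) <= gi i x.
Hypothesis phi_max : forall a, max_flow_al e lam gi gam a (phi a).

Local Notation res a := (Galpha e lam gi gam a (phi a)).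
Local Notation closed a := (closed_side (res a)).
Local Notation F a := (cut_fun (weight e lam) (label_cost gi a)).

Lemma no_augmenting a : ~~ connect (res a) (inr true) (inr false).
Proof. exact: max_flow_no_augmenting (phi_max a). Qed.

(** Closed sides are the cuts whose capacity equals the flow value, and there
    is at least one of them, the set reachable from the source. *)
Lemma closed_side_minimizer a A : closed a A <-> forall B, F a A <= F a B.
Proof.
have [K capE] := cut_cap_network lam_pos gi_ksub gam_min a.
have flow := (phi_max a).1.
have sS B : csource n \in side B by rewrite inE.
have tS B : csink n \notin side B by rewrite inE.
have tight B := tight_cutP flow (sS B) (tS B).
have below B := flow_value_le_cut flow (sS B) (tS B).
split=> [/tight|minA].
  by rewrite capE => E B; have := below B; rewrite -E capE lerD2l.
apply/tight/eqP; rewrite eq_le below andbT.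
have clR : closed a (reach (res a) set0).
  by apply: (reach_closed (no_augmenting a)) => x; rewrite inE.
by move/tight: clR => <-; rewrite !capE lerD2l.
Qed.

Lemma closed_side_uncross a b A B : a != b -> closed a A -> closed b B ->
  [/\ closed a (A :\: B), closed b (B :\: A),
      forall i, i \in A :&: B -> label_cost gi a i + label_cost gi b i = 0 &
      forall i j, i \in A :&: B -> e i j -> j \in A :|: B].
Proof.
move=> ab /closed_side_minimizer minA /closed_side_minimizer minB.
have cost_ge0 i : 0 <= label_cost gi a i + label_cost gi b i.
  by have := gi_ksub i ab; rewrite /label_cost; lra.
have [minAB minBA cost0 weight0] := cut_fun_uncross_min
  (weight_sym lam_sym e_sym) (weight_ge0 lam_pos) cost_ge0 minA minB.
split=> //; try exact/closed_side_minimizer.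
move=> i j iAB eij; apply: contraT => /(weight0 i j iAB).
by rewrite /weight eij => lam0; have := lam_pos eij; rewrite lam0 ltxx.
Qed.

Lemma closed_sideDl a b A B : a != b -> closed a A -> closed b B ->
  closed a (A :\: B).
Proof. by move=> ab clA clB; case: (closed_side_uncross ab clA clB). Qed.

Lemma closed_sideDr a b A B : a != b -> closed a A -> closed b B ->
  closed b (B :\: A).
Proof. by move=> ab clA clB; case: (closed_side_uncross ab clA clB). Qed.

(** On [X] the three costs cancel pairwise, hence vanish, and no edge leaves
    [X]. *)
Lemma three_atoms_costless a b c X : a != b -> a != c -> b != c ->
  atom (closed a) X -> atom (closed b) X -> atom (closed c) X ->
  forall i, [/\ gi i (Some a) = gi i None, gi i (Some b) = gi i None &
                gi i (Some c) = gi i None].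
Proof.
move=> ab ac bc Xa Xb Xc.
have [A [B [C [[clA clB clC] AB AC BC]]]] := atom_three_witnesses
  (fun C D => @closed_sideDr a b C D ab) (fun C D => @closed_sideDr a c C D ac)
  (fun C D => @closed_sideDr b c C D bc) Xa Xb Xc.
have [_ _ costAB edgeAB] := closed_side_uncross ab clA clB.
have [_ _ costAC edgeAC] := closed_side_uncross ac clA clC.
have [_ _ costBC edgeBC] := closed_side_uncross bc clB clC.
have Xstep i j : i \in X -> e i j -> j \in X.
  move=> iX eij; have := edgeAB i j; have := edgeAC i j; have := edgeBC i j.
  rewrite AB AC BC iX eij => /(_ isT isT) jBC /(_ isT isT) jAC /(_ isT isT) jAB.
  (* [j] avoids at most one of [A], [B] and [C]. *)
  have : [|| j \in A :&: B, j \in A :&: C | j \in B :&: C].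
    move: jAB jAC jBC; rewrite !inE.
    by case: (j \in A); case: (j \in B); case: (j \in C).
  by rewrite AB AC BC !orbb.
have [/set0Pn[i0 i0X] _ _] := Xa.
have XT i : i \in X.
  have /connectP[p] := e_conn i0 i.
  elim: p i0 i0X => [|j p IH] i0 i0X /=; first by move=> _ ->.
  by case/andP=> /(Xstep _ _ i0X); apply: IH.
move=> i; have := costAB i; have := costAC i; have := costBC i.
rewrite AB AC BC XT /label_cost => /(_ isT) ? /(_ isT) ? /(_ isT) ?.
by split; lra.
Qed.

Lemma mem_SigmaP a X :
  X \in Sigma e lam gi gam a (phi a) <-> atom (closed a) X.
Proof.
split; first exact: (inner_component_atom (no_augmenting a)).
exact: (atom_inner_component (no_augmenting a)).
Qed.

End PottsComponents.

(** Distinct nonzero labels have meet and join 0. *)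
Lemma ksubmodular1_pair (R : realType) (k : nat) (h : Sk k -> R) (a b : 'I_k) :
  ksubmodular1 h -> a != b -> 2 * h None <= h (Some a) + h (Some b).
Proof.
move=> hsub ab; have := hsub [ffun=> Some a] [ffun=> Some b].
rewrite !ffunE /sk_meet /sk_join /sk_le /=.
have neq (x y : 'I_k) : x != y -> (Some x == Some y) = false.
  by move=> xy; apply/negbTE; apply: contraNneq xy => -[->].
rewrite !neq // 1?eq_sym //; lra.
Qed.

Theorem theorem26 (R : realType) (k n : nat) (e : rel 'I_n)
    (lam : 'I_n -> 'I_n -> R) (gi : 'I_n -> Sk k -> R)
    (g : {ffun 'I_n -> Sk k} -> R)
    (g_potts : is_potts e lam gi g)
    (g_nondeg : forall a b c : 'I_k, a != b -> a != c -> b != c ->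
       exists i : 'I_n, ~ [/\ gi i (Some a) = gi i None,
                              gi i (Some b) = gi i None &
                              gi i (Some c) = gi i None])
    (gam : 'I_n -> Sk k)
    (gam_min : forall (i : 'I_n) (x : Sk k), gi i (gam i) <= gi i x)
    (phi : 'I_k -> narc k n -> R)
    (phi_max : forall al : 'I_k, max_flow_al e lam gi gam al (phi al)) :
  let S := fun al : 'I_k => Sigma e lam gi gam al (phi al) in
  let leS := fun al : 'I_k => Sigma_le e lam gi gam al (phi al) in
  let ideals_R := ideals (R_set S) (R_le S leS) in
  let Cmax_P := max_consistent_ideals (P_set S) (P_le leS) (P_inc S) in
  {in ideals_R &, injective (bar S)} /\ [set bar S J | J in ideals_R] = Cmax_P.
Proof.
case: g_potts => e_sym _ e_conn lam_sym lam_pos gi_unary _.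
have gi_ksub i a b (ab : a != b) := ksubmodular1_pair (gi_unary i) ab.
move=> S leS ideals_R Cmax_P.
have SP a X : X \in S a <-> atom (closed_side (Galpha e lam gi gam a (phi a))) X.
  exact: mem_SigmaP.
have Dl := closed_sideDl lam_pos lam_sym e_sym gi_ksub gam_min phi_max.
have Dr := closed_sideDr lam_pos lam_sym e_sym gi_ksub gam_min phi_max.
apply: bar_bijective => [X a b c ab ac bc Xa Xb|a b X Y ab Ya Yb Xa YX|
                         a b X Y ab Xa Xb Ya Yb YX].
- apply/negP => Xc; have [i] := g_nondeg _ _ _ ab ac bc; apply.
  by apply: (three_atoms_costless lam_pos lam_sym e_sym e_conn gi_ksub gam_min
    phi_max ab ac bc); apply/SP; [exact: Xa|exact: Xb|exact: Xc].
- move/SP: Ya => Ya; apply/SP.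
  apply: (atom_shared_up (fun C D => @Dl a b C D ab)
    (fun C D => @Dr a b C D ab) Ya); [exact/SP|exact/SP|].
  exact: reachable_forces YX.
apply: forces_reachable; [exact: no_augmenting|exact/SP|exact/SP|].
move/SP: Ya => Ya.
apply: (atom_shared_rev (fun C D => @Dl a b C D ab)); [exact/SP|exact/SP|exact: Ya|].
exact: reachable_forces YX.
Qed.
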